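(* Let $O$ be the origin of $\mathbb{R}^3$ and let $(x(t),y(t),z(t))$, $t_0\le t\le t_1$, be a simple curve of class $C^2$ in $\mathbb{R}^3$ that does not pass through $O$ and does not meet any of the coordinate axes. Suppose that $P=P(t)$ is a moving point in $\mathbb{R}^3$ (such that the projections $\overrightarrow{OP}_A,\overrightarrow{OP}_B,\overrightarrow{OP}_C$ of $\overrightarrow{OP}$ onto the coordinate planes are nonzero) satisfying, for $t_0\le t\le t_1$, the following conditions: 1) for $\mathcal{D}=|\overrightarrow{OP}|$, $$\frac{d\mathcal{D}}{dt}=\frac{x(t)x'(t)+y(t)y'(t)+z(t)z'(t)}{\sqrt{x^2(t)+y^2(t)+z^2(t)}},\qquad \mathcal{D}|_{t=t_0}=\sqrt{x^2(t_0)+y^2(t_0)+z^2(t_0)};$$ 2) $$\frac{d\vec e_{\overrightarrow{OP}_A}}{dt}=(x(t)y'(t)-x'(t)y(t))\frac{(-y(t),x(t),0)}{(x^2(t)+y^2(t))^{3/2}},\qquad \vec e_{\overrightarrow{OP}_A}|_{t=t_0}=\frac{(x(t_0),y(t_0),0)}{\sqrt{x^2(t_0)+y^2(t_0)}};$$ 3) $$\frac{d\vec e_{\overrightarrow{OP}_B}}{dt}=(x(t)z'(t)-x'(t)z(t))\frac{(-z(t),0,x(t))}{(x^2(t)+z^2(t))^{3/2}},\qquad \vec e_{\overrightarrow{OP}_B}|_{t=t_0}=\frac{(x(t_0),0,z(t_0))}{\sqrt{x^2(t_0)+z^2(t_0)}};$$ 4) $$\frac{d\vec e_{\overrightarrow{OP}_C}}{dt}=(y(t)z'(t)-y'(t)z(t))\frac{(0,-z(t),y(t))}{(y^2(t)+z^2(t))^{3/2}},\qquad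 \vec e_{\overrightarrow{OP}_C}|_{t=t_0}=\frac{(0,y(t_0),z(t_0))}{\sqrt{y^2(t_0)+z^2(t_0)}}.$$ Then the trajectory of $P$ is $\vec r(t)=(x(t),y(t),z(t))$, $t_0\le t\le t_1$; that is, $\overrightarrow{OP}(t)=(x(t),y(t),z(t))$ for all $t\in[t_0,t_1]$.
   Context: $\overrightarrow{OP}_A$, $\overrightarrow{OP}_B$, $\overrightarrow{OP}_C$ denote the orthogonal projections of $\overrightarrow{OP}$ onto the $xOy$, $xOz$ and $yOz$ planes, respectively. $\vec e_{\vec w}=\vec w/|\vec w|$ denotes the unit vector in the direction of a nonzero vector $\vec w$. *)

(* Defs.v *)
From Stdlib Require Import Reals.
From Coquelicot Require Import Coquelicot.
Open Scope R_scope.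

(* Coquelicot's norm on a product is the l^2 combination of the norms of the
   factors, so [norm] on [R3] is the Euclidean norm: see [norm_R3]. *)
Definition R3 : NormedModule R_AbsRing :=
  prod_NormedModule R_AbsRing
    (prod_NormedModule R_AbsRing R_NormedModule R_NormedModule) R_NormedModule.

Definition vec (x y z : R) : R3 := (x, y, z).

Lemma norm_R3 (x y z : R) : norm (vec x y z) = sqrt (x ^ 2 + y ^ 2 + z ^ 2).
Proof.
  change (sqrt (sqrt (Rabs x ^ 2 + Rabs y ^ 2) ^ 2 + Rabs z ^ 2)
          = sqrt (x ^ 2 + y ^ 2 + z ^ 2)).
  rewrite pow2_sqrt.
  - now rewrite !pow2_abs.
  - now apply Rplus_le_le_0_compat; apply pow2_ge_0.
Qed.

Definition origin : R3 := vec 0 0 0.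

Definition on_x_axis (v : R3) : Prop := let '(x, y, z) := v in y = 0 /\ z = 0.
Definition on_y_axis (v : R3) : Prop := let '(x, y, z) := v in x = 0 /\ z = 0.
Definition on_z_axis (v : R3) : Prop := let '(x, y, z) := v in x = 0 /\ y = 0.

Definition proj_xOy (v : R3) : R3 := let '(x, y, z) := v in vec x y 0.
Definition proj_xOz (v : R3) : R3 := let '(x, y, z) := v in vec x 0 z.
Definition proj_yOz (v : R3) : R3 := let '(x, y, z) := v in vec 0 y z.

(* Meaningful only for [w <> origin]. *)
Definition unit_vec (w : R3) : R3 := scal (/ norm w) w.

Definition Icc (a b : R) : R -> Prop := fun t => a <= t <= b.

(* Same as Coquelicot's [is_derive], with the limit taken inside [a, b]; for
   a < b this is the one-sided derivative at the end points. *)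
Definition is_derive_on (a b : R) {V : NormedModule R_AbsRing}
    (f : R -> V) (t : R) (l : V) : Prop :=
  filterdiff f (within (Icc a b) (locally t)) (fun h : R => scal h l).

Fixpoint class_C (k : nat) (a b : R) {V : NormedModule R_AbsRing}
    (f : R -> V) : Prop :=
  match k with
  | O => continuous_on (Icc a b) f
  | S k' => exists f' : R -> V,
      (forall t, Icc a b t -> is_derive_on a b f t (f' t)) /\ class_C k' a b f'
  end.

(* No self-intersection; a closed curve (coinciding end points) is allowed. *)
Definition simple_curve (a b : R) {T : Type} (r : R -> T) : Prop :=
  forall s t, a <= s -> s < t -> t <= b -> r s = r t -> s = a /\ t = b.

(* Main.v *)
(** Formally differentiating (x, y) / sqrt (x^2 + y^2) gives exactly the
    right-hand side prescribed for the unit vector of the projection, and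
    likewise for the distance; hence the norm of OP and the directions of its
    three projections coincide with those of r = (x, y, z) throughout
    [t0, t1]. At each instant two positive factors relating the projections of
    OP to those of r agree as soon as their planes share an axis on which r has
    a nonzero coordinate; as r avoids the axes, OP is a positive multiple of r,
    and equality of the norms makes the factor 1. *)

Require Import Defs.
From Stdlib Require Import Reals Lra.
From Coquelicot Require Import Coquelicot.
Open Scope R_scope.

(* Reduces derivatives relative to [a, b] to ordinary ones: outside [a, b] the
   extension is the tangent line at [t]. *)
Lemma is_derive_on_extend (a b : R) (f : R -> R) (t l : R) :
  Icc a b t -> is_derive_on a b f t l ->
  exists g : R -> R, is_derive g t l /\ forall s, Icc a b s -> g s = f s.
Proof.
  intros Hab [_ Hf].
  set (inside := fun s : R => if Rle_dec a s then
                     if Rle_dec s b then true else false else false).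
  assert (inside_true : forall s, Icc a b s -> inside s = true).
  { intros s [H1 H2]. unfold inside.
    destruct (Rle_dec a s); [|lra]. now destruct (Rle_dec s b); [|lra]. }
  assert (inside_Icc : forall s, inside s = true -> Icc a b s).
  { intros s. unfold inside, Icc.
    destruct (Rle_dec a s); [|easy]. now destruct (Rle_dec s b). }
  exists (fun s => if inside s then f s else f t + l * (s - t)).
  split; [|now intros s Hs; rewrite inside_true].
  split; [apply is_linear_scal_l|].
  intros x Hx eps.
  (* The only limit point of [locally t] is [t], so the remainder estimate has to be checked there
     alone. *)
  apply (is_filter_lim_locally_unique (V := R_NormedModule)) in Hx. subst x.
  assert (Hlim : is_filter_lim (within (Icc a b) (locally t)) t).
  { intros Q HQ. now apply filter_le_within. }
  generalize (Hf t Hlim eps). unfold within.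
  apply filter_imp. intros s Hs.
  rewrite (inside_true t Hab).
  destruct (inside s) eqn:E; [now apply Hs, inside_Icc|].
  (* Off the interval the extension is affine with slope [l], so its remainder vanishes
     identically. *)
  replace (minus _ _) with (zero : R_NormedModule).
  - rewrite norm_zero. apply Rmult_le_pos; [apply Rlt_le, eps|apply norm_ge_0].
  - unfold minus, plus, opp, scal, zero; simpl. unfold mult; simpl. ring.
Qed.

(** * Recovering a function on an interval from its derivative and initial value *)

Definition clamp (a b s : R) : R := Rmax a (Rmin b s).

Lemma clamp_Icc (a b s : R) : a <= b -> Icc a b (clamp a b s).
Proof.
  intros Hab. split; [apply Rmax_l|apply Rmax_lub; [easy|apply Rmin_l]].
Qed.

Lemma clamp_id (a b s : R) : Icc a b s -> clamp a b s = s.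
Proof.
  intros [H1 H2]. unfold clamp. now rewrite Rmin_right, Rmax_right.
Qed.

Lemma continuous_clamp (a b s : R) : a <= b -> continuous (clamp a b) s.
Proof.
  (* Clamping is 1-Lipschitz, so the same [eps] serves. *)
  intros Hab Q [eps HQ]. exists eps. intros u Hu. apply HQ.
  apply Rle_lt_trans with (2 := Hu).
  change (Rabs (clamp a b u - clamp a b s) <= Rabs (u - s)).
  unfold clamp, Rmax, Rmin.
  repeat destruct Rle_dec; unfold Rabs; repeat destruct Rcase_abs; lra.
Qed.

(** Mean value theorem on [[a, t]]: differentiability at interior points and continuity up to the
    end points both come from the extensions [h]. *)
Lemma constant_of_derive_zero (a b : R) (g : R -> R) :
  (forall t, Icc a b t ->
     exists h : R -> R, is_derive h t 0 /\ forall s, Icc a b s -> h s = g s) ->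
  forall t, Icc a b t -> g t = g a.
Proof.
  intros Hg t [Hat Htb].
  assert (Hab : a <= b) by lra.
  (* [G] prolongs [g] by its end values, so that two-sided continuity makes sense at the end
     points. *)
  set (G := fun s => g (clamp a b s)).
  assert (HG : forall s, Icc a b s -> G s = g s).
  { intros s Hs. unfold G. now rewrite clamp_id. }
  rewrite <- (HG t), <- (HG a) by (split; lra).
  destruct (MVT_gen G a t (fun _ => 0)) as [c [_ Hc]]; [| |lra];
    rewrite Rmin_left, Rmax_right by lra; intros s Hs.
  (* Here [s] is interior, so [h] and [G] agree on a whole neighbourhood of it. *)
  - destruct (Hg s) as [h [Hh Hhg]]; [split; lra|].
    apply is_derive_ext_loc with (2 := Hh).
    apply (locally_interval _ s a b); [simpl; lra|simpl; lra|].
    simpl. intros u H1 H2. rewrite HG by (split; lra). apply Hhg; split; lra.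
  - destruct (Hg s) as [h [Hh Hhg]]; [split; lra|].
    apply continuity_pt_filterlim.
    (* At an end point [h] may differ from [G] nearby, but [h] after clamping equals [G]
       everywhere. *)
    apply (continuous_ext (fun u => h (clamp a b u))).
    + intros u. now apply Hhg, clamp_Icc.
    + apply continuous_comp; [now apply continuous_clamp|].
      rewrite clamp_id by (split; lra).
      apply (ex_derive_continuous (V := R_NormedModule)). now exists 0.
Qed.

(** The difference [f - k] has zero derivative. Only [k] is handled through local extensions: it
    stands for an explicit formula in the curve coordinates, differentiated by the usual rules once
    these are extended. *)
Lemma is_derive_on_unique (a b : R) (f k l : R -> R) :
  (forall t, Icc a b t -> is_derive_on a b f t (l t)) ->
  (forall t, Icc a b t -> exists h : R -> R,
     is_derive h t (l t) /\ forall s, Icc a b s -> h s = k s) ->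
  f a = k a -> forall t, Icc a b t -> f t = k t.
Proof.
  intros Hf Hk H0 t Ht.
  apply Rminus_diag_uniq.
  rewrite (constant_of_derive_zero a b (fun s => f s - k s)); [lra| |easy].
  intros s Hs.
  destruct (is_derive_on_extend a b f s (l s) Hs (Hf s Hs)) as [F [HF HFf]].
  destruct (Hk s Hs) as [h [Hh Hhk]].
  exists (fun u => F u - h u). split.
  - replace 0 with (minus (l s) (l s)) by apply Rminus_diag.
    now apply (is_derive_minus (V := R_NormedModule)).
  - intros u Hu. now rewrite HFf, Hhk.
Qed.

(** * Passage from vectors to coordinates *)

Lemma is_derive_on_linear (a b : R) {V W : NormedModule R_AbsRing}
    (phi : V -> W) (f : R -> V) (t : R) (l : V) :
  is_linear phi -> is_derive_on a b f t l ->
  is_derive_on a b (fun s => phi (f s)) t (phi l).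
Proof.
  intros Hphi Hf.
  apply (filterdiff_ext_lin _ (fun h : R => phi (scal h l))).
  - apply filterdiff_comp; [easy|now apply filterdiff_linear].
  - intros h. exact (linear_scal phi Hphi h l).
Qed.

Definition coord_x (v : R3) : R := fst (fst v).
Definition coord_y (v : R3) : R := snd (fst v).
Definition coord_z (v : R3) : R := snd v.

Lemma is_linear_coord_x : is_linear coord_x.
Proof.
  exact (is_linear_comp (V := prod_NormedModule _ R_NormedModule R_NormedModule)
           fst fst is_linear_fst is_linear_fst).
Qed.

Lemma is_linear_coord_y : is_linear coord_y.
Proof.
  exact (is_linear_comp (V := prod_NormedModule _ R_NormedModule R_NormedModule)
           fst snd is_linear_fst is_linear_snd).
Qed.

Lemma is_linear_coord_z : is_linear coord_z.
Proof. exact is_linear_snd. Qed.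

Lemma vec_coord (v : R3) : v = vec (coord_x v) (coord_y v) (coord_z v).
Proof. now destruct v as [[x y] z]. Qed.

Definition is_coord (phi : R3 -> R) : Prop :=
  phi = coord_x \/ phi = coord_y \/ phi = coord_z.

Lemma coord_scal (phi : R3 -> R) (c : R) (v : R3) :
  is_coord phi -> phi (scal c v) = c * phi v.
Proof. now intros [->|[->| ->]]; destruct v as [[x y] z]. Qed.

Lemma is_derive_on_unique_R3 (a b : R) (f k l : R -> R3) :
  (forall t, Icc a b t -> is_derive_on a b f t (l t)) ->
  (forall phi : R3 -> R, is_coord phi -> forall t, Icc a b t ->
     exists h : R -> R, is_derive h t (phi (l t)) /\ forall s, Icc a b s -> h s = phi (k s)) ->
  f a = k a -> forall t, Icc a b t -> f t = k t.
Proof.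
  unfold is_coord. intros Hf Hk H0 t Ht.
  rewrite (vec_coord (f t)), (vec_coord (k t)).
  f_equal.
  - apply (is_derive_on_unique a b (fun s => coord_x (f s))
             (fun s => coord_x (k s)) (fun s => coord_x (l s))); auto.
    + intros s Hs. apply is_derive_on_linear; auto using is_linear_coord_x.
    + now rewrite H0.
  - apply (is_derive_on_unique a b (fun s => coord_y (f s))
             (fun s => coord_y (k s)) (fun s => coord_y (l s))); auto.
    + intros s Hs. apply is_derive_on_linear; auto using is_linear_coord_y.
    + now rewrite H0.
  - apply (is_derive_on_unique a b (fun s => coord_z (f s))
             (fun s => coord_z (k s)) (fun s => coord_z (l s))); auto.
    + intros s Hs. apply is_derive_on_linear; auto using is_linear_coord_z.
    + now rewrite H0.
Qed.

(** * Derivatives of the plane direction and of the distance *)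

Lemma Rpower_three_halves (q : R) : 0 < q -> Rpower q (3 / 2) = q * sqrt q.
Proof.
  intros Hq. replace (3 / 2) with (1 + / 2) by lra.
  now rewrite Rpower_plus, Rpower_1, Rpower_sqrt.
Qed.

(** Quotient rule: with [r] the plane norm, the numerator over [r ^ 3] is [dx * (X ^ 2 + Y ^ 2) - X
    * (X * dx + Y * dy)], which factors as [- Y * (X * dy - dx * Y)]. *)
Lemma is_derive_direction (X Y : R -> R) (t dx dy : R) :
  is_derive X t dx -> is_derive Y t dy -> 0 < X t ^ 2 + Y t ^ 2 ->
  is_derive (fun s => / sqrt (X s ^ 2 + Y s ^ 2) * X s) t
    ((X t * dy - dx * Y t) / Rpower (X t ^ 2 + Y t ^ 2) (3 / 2) * - Y t).
Proof.
  intros HX HY Hpos.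
  rewrite Rpower_three_halves by easy.
  pose proof (sqrt_lt_R0 _ Hpos) as Hs.
  pose proof (sqrt_sqrt _ (Rlt_le _ _ Hpos)) as Hss.
  assert (EX : ex_derive X t) by now exists dx.
  assert (EY : ex_derive Y t) by now exists dy.
  auto_derive.
  - simpl in *. repeat split; auto; lra.
  - rewrite (is_derive_unique (fun s : R => X s) _ _ HX),
      (is_derive_unique (fun s : R => Y s) _ _ HY).
    simpl in *. rewrite !Rmult_1_r in *.
    (* With [r] as an atom the identity is rational; the sum of squares is traded for [r * r] to
       simplify, then [r ^ 2] is expanded back so that both sides match. *)
    set (r := sqrt (X t * X t + Y t * Y t)) in *.
    rewrite <- Hss. field_simplify; [|lra|lra].
    replace (r ^ 2) with (X t * X t + Y t * Y t) by (rewrite <- Hss; ring).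
    field. lra.
Qed.

(** Exchanging the two coordinates reverses the sign of [X * dy - dx * Y], which absorbs the minus
    sign of the first component. *)
Lemma is_derive_direction_snd (X Y : R -> R) (t dx dy : R) :
  is_derive X t dx -> is_derive Y t dy -> 0 < X t ^ 2 + Y t ^ 2 ->
  is_derive (fun s => / sqrt (X s ^ 2 + Y s ^ 2) * Y s) t
    ((X t * dy - dx * Y t) / Rpower (X t ^ 2 + Y t ^ 2) (3 / 2) * X t).
Proof.
  intros HX HY Hpos.
  apply (is_derive_ext (fun s => / sqrt (Y s ^ 2 + X s ^ 2) * Y s)).
  { intros s. now rewrite (Rplus_comm (Y s ^ 2)). }
  replace (_ * X t) with
    ((Y t * dx - dy * X t) / Rpower (Y t ^ 2 + X t ^ 2) (3 / 2) * - X t).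
  - apply is_derive_direction; [easy|easy|lra].
  - rewrite (Rplus_comm (Y t ^ 2)). unfold Rdiv. ring.
Qed.

(* [emb] embeds a coordinate plane into space. *)
Lemma direction_unique (a b : R) (x y x' y' : R -> R) (emb : R -> R -> R3)
    (f : R -> R3) :
  (forall phi, is_coord phi ->
     (forall u v, phi (emb u v) = u) \/ (forall u v, phi (emb u v) = v) \/
     (forall u v, phi (emb u v) = 0)) ->
  (forall t, Icc a b t -> is_derive_on a b x t (x' t)) ->
  (forall t, Icc a b t -> is_derive_on a b y t (y' t)) ->
  (forall t, Icc a b t -> 0 < x t ^ 2 + y t ^ 2) ->
  (forall t, Icc a b t -> is_derive_on a b f t
     (scal ((x t * y' t - x' t * y t) / Rpower (x t ^ 2 + y t ^ 2) (3 / 2))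
        (emb (- y t) (x t)))) ->
  f a = scal (/ sqrt (x a ^ 2 + y a ^ 2)) (emb (x a) (y a)) ->
  forall t, Icc a b t ->
  f t = scal (/ sqrt (x t ^ 2 + y t ^ 2)) (emb (x t) (y t)).
Proof.
  intros Hemb Hx Hy Hpos Hf H0.
  apply (is_derive_on_unique_R3 a b f
    (fun t => scal (/ sqrt (x t ^ 2 + y t ^ 2)) (emb (x t) (y t))) _ Hf);
    [|exact H0].
  intros phi Hphi t H.
  destruct (is_derive_on_extend _ _ _ _ _ H (Hx t H)) as [X [HX EX]].
  destruct (is_derive_on_extend _ _ _ _ _ H (Hy t H)) as [Y [HY EY]].
  (* The same formula in the extended coordinates [X], [Y]: it has an ordinary derivative at [t] and
     the right values on the interval. *)
  exists (fun s => / sqrt (X s ^ 2 + Y s ^ 2) * phi (emb (X s) (Y s))).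
  split; [|now intros s Hs; rewrite EX, EY, coord_scal].
  rewrite coord_scal by easy.
  specialize (Hpos t H).
  rewrite <- EX, <- EY in * by easy.
  (* [phi] reads the first plane coordinate, the second, or the one that vanishes on the plane. *)
  destruct (Hemb phi Hphi) as [E|[E|E]]; rewrite E.
  - apply (is_derive_ext (fun s => / sqrt (X s ^ 2 + Y s ^ 2) * X s)).
    + intros s. now rewrite E.
    + now apply is_derive_direction.
  - apply (is_derive_ext (fun s => / sqrt (X s ^ 2 + Y s ^ 2) * Y s)).
    + intros s. now rewrite E.
    + now apply is_derive_direction_snd.
  - rewrite Rmult_0_r. apply (is_derive_ext (fun _ => 0)).
    + intros s. rewrite E. symmetry. apply Rmult_0_r.
    + exact (is_derive_const 0 t).
Qed.

Lemma is_derive_distance (X Y Z : R -> R) (t dx dy dz : R) :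
  is_derive X t dx -> is_derive Y t dy -> is_derive Z t dz ->
  0 < X t ^ 2 + Y t ^ 2 + Z t ^ 2 ->
  is_derive (fun s => sqrt (X s ^ 2 + Y s ^ 2 + Z s ^ 2)) t
    ((X t * dx + Y t * dy + Z t * dz) / sqrt (X t ^ 2 + Y t ^ 2 + Z t ^ 2)).
Proof.
  intros HX HY HZ Hpos.
  pose proof (sqrt_lt_R0 _ Hpos) as Hs.
  assert (EX : ex_derive X t) by now exists dx.
  assert (EY : ex_derive Y t) by now exists dy.
  assert (EZ : ex_derive Z t) by now exists dz.
  auto_derive.
  - simpl in *. repeat split; auto; lra.
  - rewrite (is_derive_unique (fun s : R => X s) _ _ HX),
      (is_derive_unique (fun s : R => Y s) _ _ HY),
      (is_derive_unique (fun s : R => Z s) _ _ HZ).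
    simpl in *. field. lra.
Qed.

(** * Reconstruction of a vector from its norm and the directions of its projections *)

Lemma sum_sq_pos (u v : R) : ~ (u = 0 /\ v = 0) -> 0 < u ^ 2 + v ^ 2.
Proof.
  intros H.
  destruct (Req_dec u 0) as [Hu|Hu].
  - assert (Hv : v <> 0) by tauto. pose proof (pow2_gt_0 v Hv). nra.
  - pose proof (pow2_gt_0 u Hu). nra.
Qed.

(** A nonzero vector is its norm times its unit vector, so the factor is [norm w * k]. *)
Lemma positive_multiple_of_unit_vec (w v : R3) (k : R) :
  w <> origin -> 0 < k -> unit_vec w = scal k v ->
  exists c, 0 < c /\ w = scal c v.
Proof.
  intros Hw Hk Hu.
  pose proof (norm_gt_0 w Hw) as Hn.
  exists (norm w * k). split; [now apply Rmult_lt_0_compat|].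
  change (norm w * k) with (mult (norm w) k).
  rewrite <- scal_assoc, <- Hu. unfold unit_vec. rewrite scal_assoc.
  replace (mult (norm w) (/ norm w)) with (one : R_AbsRing).
  - symmetry. apply scal_one.
  - change (1 = norm w * / norm w). field. lra.
Qed.

Lemma scal_vec (c x y z : R) : scal c (vec x y z) = vec (c * x) (c * y) (c * z).
Proof. reflexivity. Qed.

Lemma vec_inj (x y z u v w : R) :
  vec x y z = vec u v w -> x = u /\ y = v /\ z = w.
Proof. now intros [= -> -> ->]. Qed.

Lemma eq_of_projections (w : R3) (x y z a b c : R) :
  0 < x ^ 2 + y ^ 2 -> 0 < x ^ 2 + z ^ 2 -> 0 < y ^ 2 + z ^ 2 ->
  0 < a -> 0 < b -> 0 < c ->
  proj_xOy w = scal a (vec x y 0) ->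
  proj_xOz w = scal b (vec x 0 z) ->
  proj_yOz w = scal c (vec 0 y z) ->
  norm w = sqrt (x ^ 2 + y ^ 2 + z ^ 2) -> w = vec x y z.
Proof.
  intros Hxy Hxz Hyz Ha Hb Hc HA HB HC HN.
  destruct w as [[p q] s]. change (vec p q s = vec x y z).
  change (norm (vec p q s) = sqrt (x ^ 2 + y ^ 2 + z ^ 2)) in HN.
  rewrite norm_R3 in HN. apply sqrt_inj in HN; [|nra|nra].
  rewrite scal_vec in HA, HB, HC. simpl in HA, HB, HC.
  apply vec_inj in HA as (Hp & Hq & _), HB as (Hp' & _ & Hs),
    HC as (_ & Hq' & Hs').
  (* If [x] is nonzero, the first coordinate gives [a = b]; otherwise [y] is nonzero and the second
     gives [a = c]. *)
  assert (Hsa : s = a * z).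
  { destruct (Req_dec x 0) as [Hx|Hx].
    - assert (Hy : y <> 0) by (intros ->; subst x; lra).
      rewrite Hs'. f_equal. apply Rmult_eq_reg_r with y; lra.
    - rewrite Hs. f_equal. apply Rmult_eq_reg_r with x; lra. }
  assert (Ha1 : a = 1).
  { rewrite Hp, Hq, Hsa in HN.
    (* Equality of the squared norms, factored; [a > 0] excludes the root [a = -1]. *)
    assert ((a - 1) * ((a + 1) * (x ^ 2 + y ^ 2 + z ^ 2)) = 0) as H by lra.
    apply Rmult_integral in H as [H|H]; [lra|].
    assert (0 < (a + 1) * (x ^ 2 + y ^ 2 + z ^ 2))
      by (apply Rmult_lt_0_compat; nra). lra. }
  rewrite Hp, Hq, Hsa, Ha1. now rewrite !Rmult_1_l.
Qed.

(** * From the differential conditions to the trajectory of [P] *)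

Theorem theorem3p2 (t0 t1 : R) (x y z x' y' z' : R -> R) (P : R -> R3)
  (Ht : t0 < t1)
  (Hsimple : simple_curve t0 t1 (fun t => vec (x t) (y t) (z t)))
  (HC2 : class_C 2 t0 t1 (fun t => vec (x t) (y t) (z t)))
  (Hx' : forall t, t0 <= t <= t1 -> is_derive_on t0 t1 x t (x' t))
  (Hy' : forall t, t0 <= t <= t1 -> is_derive_on t0 t1 y t (y' t))
  (Hz' : forall t, t0 <= t <= t1 -> is_derive_on t0 t1 z t (z' t))
  (HO : forall t, t0 <= t <= t1 -> vec (x t) (y t) (z t) <> origin)
  (Haxes : forall t, t0 <= t <= t1 ->
     ~ on_x_axis (vec (x t) (y t) (z t)) /\
     ~ on_y_axis (vec (x t) (y t) (z t)) /\
     ~ on_z_axis (vec (x t) (y t) (z t)))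
  (HPproj : forall t, t0 <= t <= t1 ->
     proj_xOy (P t) <> origin /\
     proj_xOz (P t) <> origin /\
     proj_yOz (P t) <> origin)
  (HD : forall t, t0 <= t <= t1 ->
     is_derive_on t0 t1 (fun s => norm (P s)) t
       ((x t * x' t + y t * y' t + z t * z' t)
          / sqrt (x t ^ 2 + y t ^ 2 + z t ^ 2)))
  (HD0 : norm (P t0) = sqrt (x t0 ^ 2 + y t0 ^ 2 + z t0 ^ 2))
  (HA : forall t, t0 <= t <= t1 ->
     is_derive_on t0 t1 (fun s => unit_vec (proj_xOy (P s))) t
       (scal ((x t * y' t - x' t * y t) / Rpower (x t ^ 2 + y t ^ 2) (3 / 2))
          (vec (- y t) (x t) 0)))
  (HA0 : unit_vec (proj_xOy (P t0))
     = scal (/ sqrt (x t0 ^ 2 + y t0 ^ 2)) (vec (x t0) (y t0) 0))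
  (HB : forall t, t0 <= t <= t1 ->
     is_derive_on t0 t1 (fun s => unit_vec (proj_xOz (P s))) t
       (scal ((x t * z' t - x' t * z t) / Rpower (x t ^ 2 + z t ^ 2) (3 / 2))
          (vec (- z t) 0 (x t))))
  (HB0 : unit_vec (proj_xOz (P t0))
     = scal (/ sqrt (x t0 ^ 2 + z t0 ^ 2)) (vec (x t0) 0 (z t0)))
  (HC : forall t, t0 <= t <= t1 ->
     is_derive_on t0 t1 (fun s => unit_vec (proj_yOz (P s))) t
       (scal ((y t * z' t - y' t * z t) / Rpower (y t ^ 2 + z t ^ 2) (3 / 2))
          (vec 0 (- z t) (y t))))
  (HC0 : unit_vec (proj_yOz (P t0))
     = scal (/ sqrt (y t0 ^ 2 + z t0 ^ 2)) (vec 0 (y t0) (z t0))) :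
  forall t, t0 <= t <= t1 -> P t = vec (x t) (y t) (z t).
Proof.
  (* Avoiding the z-axis keeps the projection of the curve onto the xOy plane nonzero; the y- and
     x-axes do the same for xOz and yOz. *)
  assert (Hxy : forall t, Icc t0 t1 t -> 0 < x t ^ 2 + y t ^ 2).
  { intros t H. apply sum_sq_pos. apply (Haxes t H). }
  assert (Hxz : forall t, Icc t0 t1 t -> 0 < x t ^ 2 + z t ^ 2).
  { intros t H. apply sum_sq_pos. apply (Haxes t H). }
  assert (Hyz : forall t, Icc t0 t1 t -> 0 < y t ^ 2 + z t ^ 2).
  { intros t H. apply sum_sq_pos. apply (Haxes t H). }
  assert (EN : forall t, Icc t0 t1 t ->
    norm (P t) = sqrt (x t ^ 2 + y t ^ 2 + z t ^ 2)).
  { apply (is_derive_on_unique t0 t1 (fun t => norm (P t))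
      (fun t => sqrt (x t ^ 2 + y t ^ 2 + z t ^ 2)) _ HD); [|exact HD0].
    intros t H.
    destruct (is_derive_on_extend _ _ _ _ _ H (Hx' t H)) as [X [HX EX]].
    destruct (is_derive_on_extend _ _ _ _ _ H (Hy' t H)) as [Y [HY EY]].
    destruct (is_derive_on_extend _ _ _ _ _ H (Hz' t H)) as [Z [HZ EZ]].
    exists (fun s => sqrt (X s ^ 2 + Y s ^ 2 + Z s ^ 2)). split.
    - rewrite <- EX, <- EY, <- EZ by easy.
      apply is_derive_distance; auto.
      rewrite EX, EY, EZ by easy.
      pose proof (Hxy t H). pose proof (pow2_ge_0 (z t)). lra.
    - intros s Hs. now rewrite EX, EY, EZ. }
  (* Conditions 2) to 4) are one planar statement under three embeddings. *)
  pose proof (direction_unique t0 t1 x y x' y' (fun u v => vec u v 0)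
    (fun t => unit_vec (proj_xOy (P t)))) as EA.
  pose proof (direction_unique t0 t1 x z x' z' (fun u v => vec u 0 v)
    (fun t => unit_vec (proj_xOz (P t)))) as EB.
  pose proof (direction_unique t0 t1 y z y' z' (fun u v => vec 0 u v)
    (fun t => unit_vec (proj_yOz (P t)))) as EC.
  intros t H.
  destruct (HPproj t H) as (NA & NB & NC).
  destruct (positive_multiple_of_unit_vec _ (vec (x t) (y t) 0)
    (/ sqrt (x t ^ 2 + y t ^ 2)) NA) as (a & Ha & HwA).
  { now apply Rinv_0_lt_compat, sqrt_lt_R0, Hxy. }
  { apply EA; auto. intros phi [->|[->| ->]]; auto. }
  destruct (positive_multiple_of_unit_vec _ (vec (x t) 0 (z t))
    (/ sqrt (x t ^ 2 + z t ^ 2)) NB) as (b & Hb & HwB).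
  { now apply Rinv_0_lt_compat, sqrt_lt_R0, Hxz. }
  { apply EB; auto. intros phi [->|[->| ->]]; auto. }
  destruct (positive_multiple_of_unit_vec _ (vec 0 (y t) (z t))
    (/ sqrt (y t ^ 2 + z t ^ 2)) NC) as (c & Hc & HwC).
  { now apply Rinv_0_lt_compat, sqrt_lt_R0, Hyz. }
  { apply EC; auto. intros phi [->|[->| ->]]; auto. }
  apply (eq_of_projections (P t) (x t) (y t) (z t) a b c); auto.
Qed.
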